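(* Let $K\ge 1$ and, for $k=1,\dots,K$, let $a_k>0$, $b_k>0$, $P_{L,k}>0$, $\bar{\gamma}>0$, and let $p>0$, $q>0$. Let $Z_1,\dots,Z_K$ be independent, with $Z_k$ gamma distributed with shape $a_k$ and scale $b_k$ (the moment-matched gamma approximation described in the context), set $\gamma_k=\frac{\bar{\gamma}}{P_{L,k}}Z_k^2$, $\gamma^*=\max_k\gamma_k$, and $P_e=E\left[p\,Q\left(\sqrt{2q\gamma^*}\right)\right]$, where $Q(x)=\frac{1}{\sqrt{2\pi}}\int_x^\infty e^{-t^2/2}dt$. Then $$P_e=\frac{p\sqrt{q}}{2\sqrt{\pi}}\sum_{n_1=0}^{\infty}\cdots\sum_{n_K=0}^{\infty}\prod_{k=1}^{K}\frac{(-1)^{n_k}\left(\sqrt{\frac{P_{L,k}}{\bar{\gamma}b_k^2}}\right)^{a_k+n_k}}{n_k!\,(a_k+n_k)\,\Gamma(a_k)}\cdot\frac{\Gamma\left(\frac{\sum_{k=1}^{K}(a_k+n_k)}{2}+\frac12\right)}{q^{\frac{\sum_{k=1}^{K}(a_k+n_k)}{2}+\frac12}}.$$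
   Context: Model: there are $K$ reflecting surfaces; surface $k$ has $N_k$ elements with mutually independent amplitudes $\alpha_k^{(i)}$ (Nakagami-$m$, shape $m_{k,1}$, spread $\Omega_{k,1}$) and $\beta_k^{(i)}$ (Nakagami-$m$, shape $m_{k,2}$, spread $\Omega_{k,2}$), and $a_k=N_k\mu_k^2/\sigma_k^2$, $b_k=\sigma_k^2/\mu_k$, where $\mu_k,\sigma_k^2$ are the mean and variance of $\alpha_k^{(1)}\beta_k^{(1)}$; the distribution of $\sum_{i=1}^{N_k}\alpha_k^{(i)}\beta_k^{(i)}$ is approximated by the gamma law with shape $a_k$, scale $b_k$. The constants $p,q$ depend on the modulation (e.g. BPSK: $p=q=1$). $P_e$ is the average symbol error probability. *)

(* Defs.v *)
From HB Require Import structures.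
From mathcomp Require Import all_boot all_order all_algebra.
From mathcomp Require Import all_classical all_reals all_analysis.
Set Implicit Arguments. Unset Strict Implicit. Unset Printing Implicit Defensive.
Import Order.TTheory GRing.Theory Num.Theory.
Import numFieldNormedType.Exports.
Local Open Scope classical_set_scope.
Local Open Scope ring_scope.

Section Defs.
Variable R : realType.

Definition Gammaf (s : R) : R :=
  Rintegral (@lebesgue_measure R) `]0, +oo[%classic
    (fun t => powR t (s - 1) * expR (- t)).

Definition Qfun (x : R) : R :=
  (Num.sqrt (2 * pi))^-1 *
  Rintegral (@lebesgue_measure R) `[x, +oo[%classic
    (fun t => expR (- (t ^+ 2) / 2)).

Definition gamma_pdf (a b : R) (z : R) : R :=
  if 0 < z then powR z (a - 1) * expR (- z / b) / (Gammaf a * powR b a)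
  else 0.

Definition mutually_independent d (T : measurableType d)
  (P : probability T R) (K : nat) (Z : 'I_K -> T -> R) : Prop :=
  forall B : 'I_K -> set R, (forall k, measurable (B k)) ->
    P (\bigcap_(k in [set: 'I_K]) (Z k @^-1` B k)) =
    (\prod_(k < K) P (Z k @^-1` B k))%E.

Definition gamma_distributed d (T : measurableType d)
  (P : probability T R) (Z : T -> R) (a b : R) : Prop :=
  measurable_fun setT Z /\
  forall B : set R, measurable B ->
    P (Z @^-1` B) = (\int[@lebesgue_measure R]_(x in B) (gamma_pdf a b x)%:E)%E.

Fixpoint multi_series (K : nat) (f : seq nat -> R) : R :=
  match K with
  | 0 => f [::]
  | K'.+1 => limn (series (fun n => multi_series K' (fun s => f (n :: s))))
  end.

End Defs.

(* Main.v *)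
Require Import Defs.
From HB Require Import structures.
From mathcomp Require Import all_boot all_order all_algebra.
From mathcomp Require Import all_classical all_reals all_analysis.
From mathcomp Require Import measurable_realfun ring lra.
Import Order.TTheory GRing.Theory Num.Theory.
Import numFieldNormedType.Exports.
Local Open Scope classical_set_scope.
Local Open Scope ring_scope.

(* With X = sqrt (2 q max_k gamma_k), Tonelli's theorem and independence give
     E[p Q(X)] = p / sqrt (2 pi) * int_0^oo e^(-y^2/2) prod_k P(|Z_k| < w_k y) dy,
   where w_k = sqrt (PL_k / (2 q gbar)).  Expanding e^(-u/b) in the gamma density
   turns each factor into the power series
     sum_n (-1)^n (w_k y / b_k)^(a_k + n) / (n! (a_k + n) Gamma(a_k)),
   whose absolute series is at most C y^(a_k) e^(B y).  The Gaussian weight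
   makes the product of these bounds integrable, so the K series can be exchanged
   with the integral one after the other by dominated convergence.  What remains
   are the Gaussian moments int_0^oo y^S e^(-y^2/2) dy, which the substitution
   x = y^2/2 identifies with Gamma((S + 1) / 2). *)

(** * Exchange of one series with an integral *)

Section termwise_integration.
Context d (T : measurableType d) (R : realType).
Variables (mu : {measure set T -> \bar R}) (D : set T).
Hypothesis mD : measurable D.
Implicit Types (f g : T -> R) (u : nat -> T -> R).

Lemma integrable_dominated f g : measurable_fun D f ->
  (forall x, D x -> `|f x| <= g x) -> mu.-integrable D (EFin \o g) ->
  mu.-integrable D (EFin \o f).
Proof.
move=> mf fg; apply: le_integrable => //; first exact/measurable_EFinP.
by move=> x Dx /=; rewrite lee_fin (le_trans (fg x Dx))// ler_norm.
Qed.

Lemma dominated_cvg_Rintegral u f g :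
  (forall n, measurable_fun D (u n)) ->
  (forall x, D x -> u ^~ x @ \oo --> f x) ->
  (forall n x, D x -> `|u n x| <= g x) ->
  mu.-integrable D (EFin \o g) ->
  (fun n => \int[mu]_(x in D) u n x) @ \oo --> \int[mu]_(x in D) f x.
Proof.
move=> mu1 u_f u_g ig.
have mf : measurable_fun D f by exact: (@measurable_fun_cvg _ _ _ D u).
have muE n : measurable_fun D (EFin \o u n) by exact/measurable_EFinP.
have mfE : measurable_fun D (EFin \o f) by exact/measurable_EFinP.
have ufE : {ae mu, forall x, D x -> (fun n => (EFin \o u n) x) @ \oo --> (EFin \o f) x}.
  by apply: aeW => x /= Dx; apply: cvg_EFin; [exact: nearW|exact: u_f].
have ugE : {ae mu, forall x n, D x -> (`|(EFin \o u n) x| <= (EFin \o g) x)%E}.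
  by apply: aeW => x /= n Dx; rewrite lee_fin u_g.
have [fi _ lim] := dominated_convergence mD muE mfE ufE ig ugE.
apply: fine_cvg; rewrite fineK//; exact: integrable_fin_num.
Qed.

(** Bounding the partial sums of absolute values makes [g] dominate both each term, which gives
    integrability and hence additivity of the integral over finite sums, and each partial sum, which
    is what dominated convergence uses. *)
Lemma cvg_series_Rintegral u f g :
  (forall n, measurable_fun D (u n)) ->
  (forall x, D x -> series (u ^~ x) @ \oo --> f x) ->
  (forall n x, D x -> \sum_(0 <= i < n) `|u i x| <= g x) ->
  mu.-integrable D (EFin \o g) ->
  series (fun n => \int[mu]_(x in D) u n x) @ \oo --> \int[mu]_(x in D) f x.
Proof.
move=> mu1 u_f u_g ig.
have fg1 n x : D x -> `|u n x| <= g x.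
  move=> Dx; apply: le_trans (u_g n.+1 x Dx).
  by rewrite big_nat_recr//= lerDr sumr_ge0.
have fsum N x : D x -> `|series (u ^~ x) N| <= g x.
  by move=> Dx; apply: le_trans (u_g N x Dx); exact: ler_norm_sum.
have msum N : measurable_fun D (fun x => series (u ^~ x) N).
  by apply: measurable_sum.
have -> : series (fun n => \int[mu]_(x in D) u n x) =
    (fun N => \int[mu]_(x in D) series (u ^~ x) N).
  apply/funext; elim=> [|N IH].
    by rewrite /series /= big_geq//; under eq_Rintegral do rewrite big_geq//;
      rewrite Rintegral_cst// mul0r.
  rewrite seriesSr IH -RintegralD//.
  - by apply: eq_Rintegral => x _; rewrite seriesSr.
  - exact: integrable_dominated (fsum N) ig.
  - exact: integrable_dominated (fg1 N) ig.
exact: dominated_cvg_Rintegral ig.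
Qed.

End termwise_integration.

(** * Exchange of an iterated series with an integral *)

Lemma norm_series_limit_le (R : realType) (u : nat -> R) (l M : R) :
  series u @ \oo --> l -> (forall n, \sum_(0 <= i < n) `|u i| <= M) -> `|l| <= M.
Proof.
move=> /cvg_norm ul uM; apply: (cvgr_to_le ul); apply: nearW => n.
by apply: le_trans (uM n); exact: ler_norm_sum.
Qed.

Lemma measurable_fun_series_limit d (T : measurableType d) (R : realType) (D : set T)
    (u : nat -> T -> R) (f : T -> R) :
  (forall n, measurable_fun D (u n)) ->
  (forall x, D x -> series (u ^~ x) @ \oo --> f x) -> measurable_fun D f.
Proof.
move=> mu uf; apply: (@measurable_fun_cvg _ _ _ D (fun n x => series (u ^~ x) n)) => //.
by move=> n; exact: measurable_sum.
Qed.

Lemma measurable_prod_ord d (T : measurableType d) (R : realType) (D : set T) K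
    (f : 'I_K -> T -> R) :
  (forall k, measurable_fun D (f k)) ->
  measurable_fun D (fun x => \prod_(k < K) f k x).
Proof. by move=> mf; exact: measurable_prod. Qed.

(** Induction on [K], with the weight [h] left general. For a fixed outer index the term [g ord0 n]
    is absorbed into the weight and the induction hypothesis sums the inner series; the outer series
    is then summed by domination, since each limit [F k] inherits the bound [G k]. *)
Lemma multi_series_Rintegral d (T : measurableType d) (R : realType)
    (mu : {measure set T -> \bar R}) (D : set T) (mD : measurable D) (K : nat)
    (h : T -> R) (g : 'I_K -> nat -> T -> R) (F G : 'I_K -> T -> R) :
  measurable_fun D h ->
  (forall k n, measurable_fun D (g k n)) ->
  (forall k, measurable_fun D (G k)) ->
  (forall k x, D x -> series ((g k) ^~ x) @ \oo --> F k x) ->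
  (forall k n x, D x -> \sum_(0 <= i < n) `|g k i x| <= G k x) ->
  mu.-integrable D (EFin \o (fun x => `|h x| * \prod_(k < K) G k x)) ->
  multi_series K (fun s =>
    \int[mu]_(x in D) (h x * \prod_(k < K) g k (nth 0%N s k) x)) =
  \int[mu]_(x in D) (h x * \prod_(k < K) F k x).
Proof.
elim: K h g F G => [|K IH] h g F G mh mg mG gF gG ihG /=.
  by apply: eq_Rintegral => x _; rewrite !big_ord0.
have G0 k x : D x -> 0 <= G k x.
  by move=> Dx; have := gG k 0%N x Dx; rewrite big_geq.
have gG1 k n x : D x -> `|g k n x| <= G k x.
  move=> Dx; apply: le_trans (gG k n.+1 x Dx).
  by rewrite big_nat_recr//= lerDr sumr_ge0.
have FG k x : D x -> `|F k x| <= G k x.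
  by move=> Dx; apply: norm_series_limit_le (gF k x Dx) _ => n; exact: gG.
have mF k : measurable_fun D (F k).
  by apply: measurable_fun_series_limit (gF k).
transitivity (limn (series (fun n => \int[mu]_(x in D)
    (h x * g ord0 n x * \prod_(k < K) F (lift ord0 k) x)))).
  congr (limn (series _)); apply/funext => n.
  rewrite -(IH (fun x => h x * g ord0 n x) (fun k => g (lift ord0 k))
    (fun k => F (lift ord0 k)) (fun k => G (lift ord0 k)))//.
  - congr multi_series; apply/funext => s; apply: eq_Rintegral => x _.
    by rewrite big_ord_recl mulrA.
  - exact: measurable_funM.
  - by move=> k x Dx; exact: gF.
  - by move=> k m x Dx; exact: gG.
  (* A single term of the first series is at most [G ord0], so the bound with all factors also
     dominates the enlarged weight times the remaining ones. *)
  - apply: (integrable_dominated _ _ _ _ _ mD _ _ _ _ ihG) => //.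
      apply: measurable_funM; last exact: measurable_prod_ord.
      by apply: measurableT_comp => //; exact: measurable_funM.
    move=> x Dx; rewrite big_ord_recl normrM normr_id normrM -mulrA.
    rewrite [X in _ * (_ * X)]ger0_norm ?prodr_ge0//; last by move=> k _; exact: G0.
    rewrite ler_wpM2l// ler_wpM2r ?gG1// prodr_ge0// => k _; exact: G0.
apply/cvg_lim => //; apply: (cvg_series_Rintegral _ _ _ _ _ mD _ _ _ _ _ _ ihG) => //.
- move=> n; apply: measurable_funM; first exact: measurable_funM.
  exact: measurable_prod_ord.
- move=> x Dx; rewrite big_ord_recl.
  have -> : series (fun n => h x * g ord0 n x * \prod_(k < K) F (lift ord0 k) x)
      = (fun n => h x * (series ((g ord0) ^~ x) n * \prod_(k < K) F (lift ord0 k) x)).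
    apply/funext => n; rewrite /series /= mulr_suml mulr_sumr.
    by apply: eq_bigr => i _; rewrite mulrA.
  by apply: cvgMl_tmp; apply: cvgMr_tmp; exact: gF.
- move=> n x Dx.
  under eq_bigr do rewrite !normrM -mulrA.
  rewrite -mulr_sumr ler_wpM2l// big_ord_recl -mulr_suml ler_pM ?sumr_ge0//.
    exact: gG.
  by rewrite normr_prod; apply: ler_prod => k _; rewrite normr_ge0 FG.
Qed.

(** Makes the integral of the limit integrand finite and allows constants to be moved through it. *)
Lemma integrable_prod_series_limit d (T : measurableType d) (R : realType)
    (mu : {measure set T -> \bar R}) (D : set T) (mD : measurable D) (K : nat)
    (h : T -> R) (g : 'I_K -> nat -> T -> R) (F G : 'I_K -> T -> R) :
  measurable_fun D h ->
  (forall k n, measurable_fun D (g k n)) ->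
  (forall k x, D x -> series ((g k) ^~ x) @ \oo --> F k x) ->
  (forall k n x, D x -> \sum_(0 <= i < n) `|g k i x| <= G k x) ->
  mu.-integrable D (EFin \o (fun x => `|h x| * \prod_(k < K) G k x)) ->
  mu.-integrable D (EFin \o (fun x => h x * \prod_(k < K) F k x)).
Proof.
move=> mh mg gF gG; apply: integrable_dominated => //.
  apply: measurable_funM => //; apply: measurable_prod_ord => k.
  by apply: measurable_fun_series_limit (gF k).
move=> x Dx; rewrite normrM ler_wpM2l// normr_prod; apply: ler_prod => k _.
rewrite normr_ge0/=; apply: norm_series_limit_le (gF k x Dx) _ => n; exact: gG.
Qed.

(** * Integrals of real powers near the origin *)

Section power_integrals.
Context {R : realType}.
Notation mu := (@lebesgue_measure R).

Lemma continuous_powR (s x : R) : 0 < x -> {for x, continuous (@powR R ^~ s)}.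
Proof.
move=> x0; apply/differentiable_continuous/derivable1_diffP.
by apply: derivable_powR; rewrite in_itv/= x0.
Qed.

Lemma integral0c_powR (s z : R) : 0 < s -> 0 < z ->
  (\int[mu]_(x in `]0%R, z]) (x `^ (s - 1))%:E = (z `^ s / s)%:E)%E.
Proof.
move=> s0 z0.
(* For s < 1 the integrand is singular at 0, hence the exhaustion by [a n, z]. *)
pose a n : R := z / n.+2%:R.
have a0 n : 0 < a n by rewrite divr_gt0.
(* The offset in [n.+2] keeps the interval nondegenerate already at [n = 0], as the fundamental
   theorem of calculus requires. *)
have az n : a n < z by rewrite ltr_pdivrMr// ltr_pMr// ltr1n.
have aS m n : (m <= n)%N -> a n <= a m.
  by move=> mn; rewrite ler_pM2l// lef_pV2 ?posrE// ler_nat.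
have cva : a @ \oo --> (0 : R).
  rewrite -[X in _ --> X](mulr0 z); apply: cvgMl_tmp.
  by have := @cvg_harmonic R; rewrite -cvg_shiftS.
have UE : `]0, z]%classic = \bigcup_n `[a n, z]%classic.
  apply/seteqP; split=> [x /=|x [n _]] /=; rewrite !in_itv/= => /andP[x0 xz]; last first.
    by rewrite xz (lt_le_trans (a0 n)).
  near \oo => n; exists n => //=; rewrite in_itv/= xz andbT.
  near: n; apply: (cvgr_le 0) => //.
have cv : (\int[mu]_(x in `[a n, z]) (x `^ (s - 1))%:E)%E @[n --> \oo]
    --> (\int[mu]_(x in `]0%R, z]) (x `^ (s - 1))%:E)%E.
  rewrite UE; apply: (@ge0_nondecreasing_set_cvg_integral _ (measurableTypeR R) R
    (fun n => `[a n, z]%classic)).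
  - move=> m n mn; rewrite subsetEset => x /=; rewrite !in_itv/= => /andP[ax ->].
    by rewrite (le_trans _ ax)// aS.
  - by move=> n.
  - by move=> n; apply/measurable_EFinP; apply: measurable_funTS; exact: measurable_powR.
  - by move=> n x _; rewrite lee_fin powR_ge0.
have aE n : (\int[mu]_(x in `[a n, z]) (x `^ (s - 1))%:E =
    (z `^ s / s - a n `^ s / s)%:E)%E.
  rewrite (@continuous_FTC2 _ _ (fun x => x `^ s / s))//.
  + apply: continuous_in_subspaceT => x; rewrite inE/= in_itv/= => /andP[ax _].
    by apply: continuous_powR; exact: lt_le_trans ax.
  + have cF x : 0 < x -> {for x, continuous (fun x : R => x `^ s / s)}.
      by move=> x0; apply: cvgMr_tmp; exact: continuous_powR.
    split.
    * move=> x; rewrite in_itv/= => /andP[ax _].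
      apply: derivableM => //; apply: derivable_powR.
      by rewrite in_itv/= andbT (lt_trans (a0 n)).
    * by apply: cvg_at_right_filter; exact: cF.
    * by apply: cvg_at_left_filter; exact: cF.
  + move=> x; rewrite in_itv/= => /andP[ax _].
    have x0 : 0 < x by exact: lt_trans ax.
    rewrite derive1Mr; last by apply: derivable_powR; rewrite in_itv/= x0.
    by rewrite powR_derive1 ?in_itv/= ?x0// mulrAC divff ?mul1r// gt_eqF.
have {aE} aE := funext aE.
(* Monotone convergence gave one limit of these integrals. The explicit values give the other,
   because the lower boundary term tends to 0 for [s > 0]. *)
rewrite aE in cv; apply: (cvg_unique _ cv) => //.
apply: cvg_EFin; first exact: nearW.
rewrite -[X in _ --> X]subr0; apply: cvgB; first exact: cvg_cst.
rewrite -[X in _ --> X](mul0r s^-1); apply: cvgMr_tmp.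
by have /cvg_at_rightP := powR_cvg0 s0; apply; split.
Unshelve. all: by end_near. Qed.

End power_integrals.

(** * The substitution x = t^2/2 on the half-line *)

Section sqr_half.
Context {R : realType}.
Notation mu := (@lebesgue_measure R).

Lemma ge0_integral_subst_sqr_half (G : R -> R) :
  (forall x, 0 < x -> {for x, continuous G}) -> (forall x, 0 < x -> 0 <= G x) ->
  (\int[mu]_(x in `]0%R, +oo[) (G x)%:E =
   \int[mu]_(t in `]0%R, +oo[) (G (t ^+ 2 / 2) * t)%:E)%E.
Proof.
move=> cG G0.
(* G may be singular at 0 and F' is unbounded at +oo, so the substitution is
   performed on compact intervals exhausting the half-line. *)
pose F (t : R) := t ^+ 2 / 2.
pose a n : R := n.+1%:R^-1.
pose b n : R := n.+1%:R.
have a0 n : 0 < a n by rewrite invr_gt0.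
have ab n : a n <= b n by rewrite (@le_trans _ _ 1)// ?invf_le1// ler1n.
have aS m n : (m <= n)%N -> a n <= a m by move=> mn; rewrite lef_pV2 ?posrE// ler_nat.
have bS m n : (m <= n)%N -> b m <= b n by move=> mn; rewrite ler_nat.
have Flt x y : 0 <= x -> x < y -> F x < F y.
  by move=> x0 xy; rewrite ltr_pM2r ?invr_gt0// ltr_pXn2r// ?nnegrE ?(le_trans x0) ?ltW.
have Fle x y : 0 <= x -> x <= y -> F x <= F y.
  by move=> x0; rewrite le_eqVlt => /predU1P[->//|xy]; exact/ltW/Flt.
have F0 x : 0 < x -> 0 < F x by move=> x0; rewrite divr_gt0 ?exprn_gt0.
have dF x : derivable F x 1 by apply: derivableM => //; exact: exprn_derivable.
have F'E : F^`()%classic = id.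
  apply/funext => x; rewrite derive1Mr; last exact: exprn_derivable.
  by rewrite exp_derive1/= expr1 scaler_nat -[x *+ 2]mulr_natr mulfK.
have cF : continuous F.
  by move=> x; apply/differentiable_continuous/derivable1_diffP.
have ex x : 0 < x -> exists n, a n <= x <= b n.
  move=> x0; near \oo => n; exists n; apply/andP; split.
    by near: n; apply: (cvgr_le 0) => //; exact: cvg_harmonic.
  near: n; near=> n; apply: (@le_trans _ _ n%:R); last by rewrite ler_nat.
  by near: n; exact: nbhs_infty_ger.
have U1 : `]0, +oo[%classic = \bigcup_n `[a n, b n]%classic.
  apply/seteqP; split=> [x /=|x [n _]] /=; rewrite !in_itv/= ?andbT.
    by move=> /ex[n anb]; exists n => //=; rewrite in_itv.
  by move=> /andP[/(lt_le_trans (a0 n))].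
(* The preimage of [x] under [F] is [Num.sqrt (x * 2)]; the interval that contains it is mapped by
   the increasing [F] to one that contains [x]. *)
have U2 : `]0, +oo[%classic = \bigcup_n `[F (a n), F (b n)]%classic.
  apply/seteqP; split=> [x /=|x [n _]] /=; rewrite !in_itv/= ?andbT.
    move=> x0; have y0 : 0 < Num.sqrt (x * 2) by rewrite sqrtr_gt0 mulr_gt0.
    have xE : x = F (Num.sqrt (x * 2)).
      by rewrite /F sqr_sqrtr ?mulfK// mulr_ge0// ltW.
    have [n /andP[an bn]] := ex _ y0; exists n => //=.
    by rewrite in_itv/= xE !Fle// ltW.
  by move=> /andP[/(lt_le_trans (F0 _ (a0 n)))].
have mG0 : measurable_fun (`]0, +oo[%classic : set R) G.
  apply: open_continuous_measurable_fun => // x.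
  by rewrite inE/= in_itv/= andbT => /cG.
have mGF : measurable_fun (`]0, +oo[%classic : set R) (fun t => G (F t) * t).
  apply: open_continuous_measurable_fun => // x.
  rewrite inE/= in_itv/= andbT => x0; apply: cvgM => //.
  by apply: continuous_comp; [exact: cF|apply: cG; exact: F0].
have cvl : (\int[mu]_(x in `[F (a n), F (b n)]) (G x)%:E)%E @[n --> \oo]
    --> (\int[mu]_(x in `]0%R, +oo[) (G x)%:E)%E.
  rewrite U2; apply: (@ge0_nondecreasing_set_cvg_integral _ (measurableTypeR R) R
    (fun n => `[F (a n), F (b n)]%classic)) => //.
  - move=> m n mn; rewrite subsetEset => x /=; rewrite !in_itv/= => /andP[ax xb].
    apply/andP; split; first by apply: le_trans ax; rewrite Fle ?aS ?ltW.
    by apply: (le_trans xb); rewrite Fle ?bS.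
  - move=> n; apply/measurable_EFinP; apply: measurable_funS mG0 => // x/=; rewrite !in_itv/= andbT.
    by move=> /andP[/(lt_le_trans (F0 _ (a0 n)))].
  - move=> n x /=; rewrite in_itv/= => /andP[ax _].
    by rewrite lee_fin G0// (lt_le_trans (F0 _ (a0 n))).
have cvr : (\int[mu]_(t in `[a n, b n]) (G (F t) * t)%:E)%E @[n --> \oo]
    --> (\int[mu]_(t in `]0%R, +oo[) (G (F t) * t)%:E)%E.
  rewrite U1; apply: (@ge0_nondecreasing_set_cvg_integral _ (measurableTypeR R) R
    (fun n => `[a n, b n]%classic)) => //.
  - move=> m n mn; rewrite subsetEset => x /=; rewrite !in_itv/= => /andP[ax xb].
    by rewrite (le_trans _ ax) ?aS// (le_trans xb)// bS.
  - move=> n; apply/measurable_EFinP; apply: measurable_funS mGF => // x/=.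
    by rewrite !in_itv/= andbT => /andP[/(lt_le_trans (a0 n))].
  - move=> n x /=; rewrite in_itv/= => /andP[ax _].
    have x0 := lt_le_trans (a0 n) ax.
    by rewrite lee_fin mulr_ge0 ?G0 ?F0// ltW.
apply: (cvg_unique _ cvl) => //; apply: cvg_trans cvr; apply: near_eq_cvg.
apply: nearW => n.
rewrite (@integration_by_substitution_increasing _ F G)//.
- by apply: eq_integral => t _; rewrite F'E.
- move=> x y; rewrite in_itv/= => /andP[ax _] _; apply: Flt.
  by rewrite (le_trans _ ax)// ltW.
- by move=> x _; rewrite F'E.
- by rewrite F'E; apply/cvg_ex; exists (a n); apply: cvg_at_right_filter; exact: cvg_id.
- by rewrite F'E; apply/cvg_ex; exists (b n); apply: cvg_at_left_filter; exact: cvg_id.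
- split; [by move=> x _; exact: dF|apply: cvg_at_right_filter|apply: cvg_at_left_filter]; exact: cF.
- apply: continuous_in_subspaceT => x; rewrite inE/= in_itv/= => /andP[ax _].
  by apply: cG; exact: lt_le_trans (F0 _ (a0 n)) ax.
Unshelve. all: by end_near. Qed.

End sqr_half.

(** * Gaussian moments and the Gamma function *)

Section gaussian_moments.
Context {R : realType}.
Notation mu := (@lebesgue_measure R).

Lemma gt0_powR_expR (x s : R) : 0 < x -> x `^ s = expR (s * ln x).
Proof. by move=> x0; rewrite /powR gt_eqF. Qed.

Lemma measurable_expR_sqr_half (D : set R) :
  measurable_fun D (fun t : R => expR (- (t ^+ 2) / 2)).
Proof.
apply: measurable_funTS; apply: measurableT_comp => //.
by apply: measurable_funM => //; apply: measurableT_comp.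
Qed.

Lemma integrable_expRN :
  mu.-integrable `]0, +oo[%classic (EFin \o (fun t => expR (- t))).
Proof.
apply: (@eq_integrable _ _ _ mu _ _ (EFin \o exponential_pdf 1)) => //.
  move=> t; rewrite inE/= in_itv/= andbT => t0.
  by rewrite exponential_pdfE ?ltW// mul1r mulN1r.
by apply: integrableS (integrable_exponential_pdf ltr01).
Qed.

(** From ln t <= t one gets t^A <= e^(A t). Expanding (t - (A + B + 1))^2 >= 0 then bounds the
    exponent by (A + B + 1)^2/2 - t, so the integrand is at most [C] times e^(-t). *)
Lemma integrable_powR_expR_gauss (A B : R) : 0 <= A ->
  mu.-integrable `]0, +oo[%classic
    (EFin \o (fun t => expR (- (t ^+ 2) / 2) * (t `^ A * expR (B * t)))).
Proof.
move=> A0; pose C : R := expR ((A + B + 1) ^+ 2 / 2).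
apply: (@le_integrable _ _ _ mu _ _ _
    (fun t => (C%:E * (EFin \o (fun t => expR (- t))) t)%E)) => //.
- apply/measurable_EFinP; apply: measurable_funM.
    exact: measurable_expR_sqr_half.
  apply: measurable_funM; first by apply: measurable_funTS; exact: measurable_powR.
  by apply: measurable_funTS; apply: measurableT_comp => //; exact: measurable_funM.
- move=> t /=; rewrite in_itv/= andbT => t0.
  rewrite lee_fin ger0_norm ?mulr_ge0 ?expR_ge0 ?powR_ge0//.
  rewrite ger0_norm ?mulr_ge0 ?expR_ge0//.
  rewrite gt0_powR_expR// -!expRD ler_expR.
  have : A * ln t <= A * t by rewrite ler_wpM2l// ltW// ln_sublinear.
  have : 0 <= (t - (A + B + 1)) ^+ 2 by exact: sqr_ge0.
  move: (ln t) => l; nra.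
- by apply: integrableZl => //; exact: integrable_expRN.
Qed.

Lemma integrable_powR_gauss (A : R) : 0 <= A ->
  mu.-integrable `]0, +oo[%classic
    (EFin \o (fun t => t `^ A * expR (- (t ^+ 2) / 2))).
Proof.
move=> A0; have := integrable_powR_expR_gauss A 0 A0.
congr (_.-integrable _ (_ \o _)); apply/funext => t.
by rewrite mul0r expR0 mulr1 mulrC.
Qed.

Lemma Rintegral_powR_gauss (S : R) : 0 <= S ->
  \int[mu]_(t in `]0, +oo[) (t `^ S * expR (- (t ^+ 2) / 2)) =
  2 `^ ((S - 1) / 2) * Gammaf (S / 2 + 2^-1).
Proof.
move=> S0; have p0 : 0 < 2 `^ ((S - 1) / 2) :> R by rewrite powR_gt0.
have pV : (2 `^ ((S - 1) / 2))^-1 != 0 :> R by rewrite invr_eq0 gt_eqF.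
(* With the power of 2 on the Gaussian side, the two integrands agree pointwise after the
   substitution, where x^((S-1)/2) dx becomes 2^(-(S-1)/2) t^S dt. *)
apply: (mulfI pV).
rewrite mulrA mulVf ?gt_eqF// mul1r.
rewrite -RintegralZl//; last exact: integrable_powR_gauss.
rewrite /Gammaf /Rintegral [in RHS]ge0_integral_subst_sqr_half; last 2 first.
- move=> x x0; apply: cvgM; first exact: continuous_powR.
  apply: continuous_comp; last exact: continuous_expR.
  by apply: cvgN; exact: cvg_id.
- by move=> x x0; rewrite mulr_ge0 ?powR_ge0 ?expR_ge0.
congr fine; apply: eq_integral => t; rewrite inE/= in_itv/= andbT => t0.
(* Once every power, and [t] itself, is an exponential, only an identity between exponents remains,
   linear in [ln t] and [ln 2]. *)
congr EFin; rewrite -powRN !gt0_powR_expR// ?divr_gt0 ?exprn_gt0//.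
rewrite ln_div ?posrE ?exprn_gt0// lnXn//.
rewrite -[X in _ = _ * X](lnK t0) -!expRD; congr expR.
by field.
Qed.

End gaussian_moments.

(** * Power series of the gamma distribution function *)

Section gamma_cdf_series.
Context {R : realType}.
Notation mu := (@lebesgue_measure R).

(** The n-th term of the power series of the regularized lower incomplete gamma function at z/b. *)
Definition gamma_cdf_term (a b : R) (n : nat) (z : R) : R :=
  (-1) ^+ n * (z / b) `^ (a + n%:R) / (n`!%:R * (a + n%:R) * Gammaf a).

Lemma Gammaf_ge0 (a : R) : 0 <= Gammaf a.
Proof. by apply: Rintegral_ge0 => x _; rewrite mulr_ge0 ?powR_ge0 ?expR_ge0. Qed.

Lemma sum_exp_coeff_le (x : R) n : 0 <= x -> \sum_(0 <= i < n) exp_coeff x i <= expR x.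
Proof.
move=> x0; apply: (@nondecreasing_cvgn_le R (series (exp_coeff x))).
  by apply/nondecreasing_seqP => m; rewrite seriesSr lerDl divr_ge0 ?exprn_ge0.
exact: is_cvg_series_exp_coeff.
Qed.

Lemma norm_exp_coeff (x : R) n : `|exp_coeff x n| = exp_coeff `|x| n.
Proof. by rewrite /exp_coeff /= normrM normfV normrX normr_nat. Qed.

Lemma powR_addn (x s : R) n : 0 < x -> x `^ (s + n%:R) = x `^ s * x ^+ n.
Proof.
by move=> x0; rewrite powRD ?powR_mulrn ?(ltW x0)// (gt_eqF x0) implybT.
Qed.

(** Since 1/(a + i) <= 1/a, each absolute term is at most a fixed constant times the i-th term of
    the exponential series at z/b. *)
Lemma sum_gamma_cdf_term_le (a b z : R) n : 0 < a -> 0 < b -> 0 < z ->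
  \sum_(0 <= i < n) `|gamma_cdf_term a b i z| <=
  (z / b) `^ a / (a * Gammaf a) * expR (z / b).
Proof.
move=> a0 b0 z0; have zb0 : 0 < z / b by rewrite divr_gt0.
have c0 : 0 <= (z / b) `^ a / (a * Gammaf a).
  by rewrite divr_ge0 ?powR_ge0// mulr_ge0 ?Gammaf_ge0// ltW.
apply: le_trans (ler_wpM2l c0 (sum_exp_coeff_le _ n (ltW zb0))).
rewrite mulr_sumr; apply: ler_sum => i _.
have ai0 : 0 < a + i%:R by rewrite ltr_pwDl.
rewrite /gamma_cdf_term -mulrA normrMsign ger0_norm; last first.
  by rewrite divr_ge0 ?powR_ge0// !mulr_ge0 ?Gammaf_ge0// ltW.
rewrite powR_addn//.
rewrite /exp_coeff /= !invfM.
have ai : (a + i%:R)^-1 <= a^-1.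
  by rewrite lef_pV2 ?posrE ?lerDl.
(* The two regroupings put [(a + i%:R)^-1] and [a^-1] last, behind a common nonnegative factor. *)
have -> : forall u v w x y : R, u * v * (w * x * y) = (u * v * w * y) * x.
  by move=> *; ring.
have -> : forall u v w x y : R, u * (v * w) * (x * y) = (u * x * y * w) * v.
  by move=> *; ring.
by rewrite ler_wpM2l// !mulr_ge0 ?powR_ge0 ?exprn_ge0 ?invr_ge0 ?Gammaf_ge0 ?ltW.
Qed.

Lemma integrable0c_powR (s z : R) : 0 < s -> 0 < z ->
  mu.-integrable `]0, z]%classic (EFin \o (fun x => x `^ (s - 1))).
Proof.
move=> s0 z0; apply/integrableP; split.
  by apply/measurable_EFinP; apply: measurable_funTS; exact: measurable_powR.
under eq_integral do rewrite /= ger0_norm ?powR_ge0//.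
by rewrite integral0c_powR// ltry.
Qed.

(** Expanding e^(-u/b) in the density leaves multiples of u^(a+n-1), whose integrals over ]0, z] are
    the terms. On that interval the absolute partial sums are at most a constant times e^(z/b)
    u^(a-1), which is integrable because a > 0. *)
Lemma cvg_series_gamma_cdf_term (a b z : R) : 0 < a -> 0 < b -> 0 < z ->
  series ((gamma_cdf_term a b) ^~ z) @ \oo -->
  \int[mu]_(u in `]0, z]) gamma_pdf a b u.
Proof.
move=> a0 b0 z0; pose c := (Gammaf a * b `^ a)^-1.
have c0 : 0 <= c by rewrite invr_ge0 mulr_ge0 ?Gammaf_ge0 ?powR_ge0.
pose f n (u : R) : R := c * (u `^ (a - 1) * exp_coeff (- u / b) n).
have fE n : {in `]0, z]%classic, f n =1
    (fun u => (c * (-1) ^+ n / b ^+ n / n`!%:R) * u `^ (a + n%:R - 1))}.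
  move=> u; rewrite inE/= in_itv/= => /andP[u0 _].
  rewrite /f addrAC powR_addn// /exp_coeff /= mulNr -[- (u / b)]mulN1r !exprMn exprVn.
  by ring.
have -> : (gamma_cdf_term a b) ^~ z = (fun n => \int[mu]_(u in `]0, z]) f n u).
  apply/funext => n.
  have -> : \int[mu]_(u in `]0, z]) f n u = \int[mu]_(u in `]0, z])
      ((c * (-1) ^+ n / b ^+ n / n`!%:R) * u `^ (a + n%:R - 1)).
    by apply: eq_Rintegral => u uz; exact: fE.
  have an0 : 0 < a + n%:R by rewrite ltr_pwDl.
  rewrite RintegralZl//; last exact: integrable0c_powR.
  rewrite /Rintegral integral0c_powR//= /gamma_cdf_term /c !powR_addn ?divr_gt0//.
  have bV : b^-1 `^ a = (b `^ a)^-1.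
    by rewrite -[b^-1]powR_inv1 ?ltW// -powRrM mulN1r powRN.
  rewrite powRM ?invr_ge0 ?ltW// bV.
  by rewrite !exprMn exprVn !invfM; ring.
apply: (cvg_series_Rintegral _ _ R mu `]0, z]%classic _ f (gamma_pdf a b)
  (fun u => c * expR (z / b) * u `^ (a - 1))) => //.
- move=> n; apply: measurable_funM => //; apply: measurable_funM.
    by apply: measurable_funTS; exact: measurable_powR.
  apply: measurable_funM => //; apply: measurable_funX.
  by apply: measurable_funM => //; exact: measurableT_comp.
- move=> u /=; rewrite in_itv/= => /andP[u0 _]; rewrite /gamma_pdf u0.
  have -> : series (f ^~ u) =
      (fun N => c * (u `^ (a - 1) * series (exp_coeff (- u / b)) N)).
    by apply/funext => N; rewrite /series /= !mulr_sumr.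
  rewrite [X in _ --> X]mulrC; apply: cvgMl_tmp; apply: cvgMl_tmp.
  exact: is_cvg_series_exp_coeff.
- move=> n u /=; rewrite in_itv/= => /andP[u0 uz].
  have nf i : `|f i u| = c * (u `^ (a - 1) * exp_coeff `|- u / b| i).
    rewrite /f normrM (ger0_norm c0) normrM (ger0_norm (powR_ge0 _ _)).
    by rewrite norm_exp_coeff.
  under eq_bigr do rewrite nf.
  rewrite -!mulr_sumr -mulrA ler_wpM2l// mulrC ler_wpM2r ?powR_ge0//.
  apply: (le_trans (sum_exp_coeff_le _ _ _)) => //.
  rewrite ler_expR normrM normrN !gtr0_norm ?invr_gt0//.
  by rewrite ler_pM2r ?invr_gt0.
- exact: (integrableZl _ (c * expR (z / b)) (integrable0c_powR a z a0 z0)).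
Qed.

End gamma_cdf_series.

(** * The expectation of Q as a Gaussian integral of a distribution function *)

Section expectation_Qfun.
Context d {T : measurableType d} {R : realType} (P : probability T R).
Notation mu := (@lebesgue_measure R).
Local Open Scope ereal_scope.
Let gauss (y : R) : R := expR (- (y ^+ 2) / 2)%R.

(** The strict indicator yields the open half-line and [Qfun] the closed one; they differ by a null
    point. For [x >= 0] the tail lies in a half-line where the Gaussian is known to be integrable,
    so the integral is finite. *)
Lemma integral_tail_gauss (x : R) : (0 <= x)%R ->
  \int[mu]_y ((x < y)%R%:R * gauss y)%:E =
  (\int[mu]_(y in `[x, +oo[) gauss y)%R%:E.
Proof.
move=> x0.
have i0 : mu.-integrable `]0%R, +oo[%classic (EFin \o gauss).
  have <- : (fun t : R => t `^ 0 * expR (- (t ^+ 2) / 2))%R = gauss.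
    by apply/funext => t; rewrite powRr0 mul1r.
  exact: integrable_powR_gauss.
have io : mu.-integrable `]x, +oo[%classic (EFin \o gauss).
  by apply: integrableS i0 => //; apply: subset_itvr; rewrite bnd_simp.
rewrite -Rintegral_itv_obnd_cbnd// /Rintegral fineK; last exact: integrable_fin_num.
rewrite [RHS]integral_mkcond; apply: eq_integral => y _.
rewrite patchE; case: ifPn => [|/negP]; rewrite inE/= in_itv/= andbT.
  by move=> ->; rewrite mul1r.
by move=> /negP/negbTE ->; rewrite mul0r.
Qed.

(** Q(X) is an integral over the levels y above X; Tonelli's theorem integrates over the sample
    space first, which turns the indicator of X < y into its probability. *)
Lemma integral_Qfun (X : T -> R) (p : R) :
  measurable_fun setT X -> (forall t, 0 <= X t)%R -> (0 <= p)%R ->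
  \int[P]_t (p * Qfun (X t))%:E = (p / Num.sqrt (2 * pi))%:E *
  \int[mu]_(y in `]0%R, +oo[) ((gauss y)%:E * P [set t | X t < y]%R).
Proof.
move=> mX X0 p0.
pose f (z : T * measurableTypeR R) : \bar R := ((X z.1 < z.2)%R%:R * gauss z.2)%:E.
have c0 : (0 <= p / Num.sqrt (2 * pi))%R by rewrite divr_ge0 ?sqrtr_ge0.
have f0 z : 0 <= f z by rewrite lee_fin mulr_ge0 ?expR_ge0.
have mf : measurable_fun setT f.
  apply/measurable_EFinP; apply: measurable_funM.
    have -> : (fun z : T * measurableTypeR R => (X z.1 < z.2)%R%:R) =
        (fun z => if (X z.1 < z.2)%R then 1%R else 0%R) :> (_ -> R).
      by apply/funext => z; case: ifP.
    apply: measurable_fun_ifT => //; apply: measurable_fun_ltr => //.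
    exact: measurableT_comp.
  apply: (measurableT_comp (f := gauss)) => //.
  exact: measurable_expR_sqr_half.
transitivity (\int[P]_t ((p / Num.sqrt (2 * pi))%:E * \int[mu]_y f (t, y))).
  apply: eq_integral => t _; rewrite /f/= integral_tail_gauss// -EFinM.
  by rewrite /Qfun mulrA.
rewrite ge0_integralZl//; last 2 first.
- exact: (measurable_fun_fubini_tonelli_F f).
- by move=> t _; exact: integral_ge0.
congr (_ * _); rewrite (fubini_tonelli f)// [RHS]integral_mkcond.
have mXlt y : measurable [set t | X t < y]%R.
  have := measurable_fun_ltr mX (measurable_cst y).
  by move=> /(_ measurableT [set true]); rewrite setTI; exact.
apply: eq_integral => y _; transitivity ((gauss y)%:E * P [set t | X t < y]%R).
  rewrite -[in RHS](setIT [set t | X t < y]%R) -integral_indic//.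
  rewrite -ge0_integralZl//.
  - apply: eq_integral => t _; rewrite /f/= -EFinM indicE mulrC.
    have -> // : (t \in [set t | X t < y]%R) = (X t < y)%R.
    by apply/idP/idP; [rewrite inE|move=> ?; rewrite inE].
  - exact/measurable_EFinP/measurable_indic.
  - by rewrite lee_fin expR_ge0.
(* Levels [y <= 0] contribute nothing: as [X] is nonnegative, the event is empty. *)
rewrite patchE; case: ifPn => // /negP; rewrite inE/= in_itv/= andbT => y0.
rewrite (_ : [set t | _] = set0) ?measure0 ?mule0//.
by apply/seteqP; split => // t /= Xy; apply: y0; exact: le_lt_trans Xy.
Qed.

End expectation_Qfun.

(** * Probabilities of symmetric intervals *)

Section gamma_distributed.
Context d {T : measurableType d} {R : realType} (P : probability T R).
Notation mu := (@lebesgue_measure R).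

(** Squaring [Z] leads to events |Z| < w. The density vanishes on the nonpositive axis and the
    endpoint [w] is null; a probability is finite, so the real-valued integral loses nothing. *)
Lemma gamma_distributed_sym_itv (Z : T -> R) (a b w : R) :
  gamma_distributed P Z a b -> 0 < w ->
  P (Z @^-1` `]- w, w[) = (\int[mu]_(u in `]0, w]) gamma_pdf a b u)%:E.
Proof.
move=> [mZ ZE] w0; have /= Zw := ZE `]- w, w[%classic (measurable_itv _).
have E : (\int[mu]_(u in `](- w)%R, w[) (gamma_pdf a b u)%:E =
    \int[mu]_(u in `]0%R, w]) (gamma_pdf a b u)%:E)%E.
  rewrite -integral_itv_bndo_bndc; last first.
    apply/measurable_EFinP/measurable_funTS; apply: measurable_fun_ifT => //.
      exact: measurable_fun_ltr.
    apply: measurable_funM => //; apply: measurable_funM; first exact: measurable_powR.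
    by apply: measurableT_comp => //; apply: measurable_funM.
  rewrite integral_mkcond [RHS]integral_mkcond; apply: eq_integral => u _.
  rewrite !patchE /gamma_pdf; have [u0|u0] := ltP 0 u; last by do 2 case: ifP.
  congr (if _ then _ else _); apply/idP/idP; rewrite !inE/= !in_itv/= u0/=.
    by move=> /andP[_ ->].
  by move=> ->; rewrite andbT (lt_trans _ u0)// oppr_lt0.
rewrite /Rintegral fineK -E -Zw//; apply: fin_num_measure.
by rewrite -[X in measurable X]setTI; apply: mZ.
Qed.

End gamma_distributed.

Lemma prod_powR (R : realType) (I : Type) (s : seq I) (x : R) (f : I -> R) : 0 < x ->
  \prod_(i <- s) x `^ f i = x `^ (\sum_(i <- s) f i).
Proof.
move=> x0; rewrite gt0_powR_expR// mulr_suml expR_sum.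
by apply: eq_bigr => i _; rewrite gt0_powR_expR.
Qed.

(** * The event that the maximum stays below a level *)

Section max_of_scaled_squares.
Context {R : realType}.
Variables (K : nat) (PL : 'I_K -> R) (gbar q : R).
Hypotheses (PL0 : forall k, 0 < PL k) (gbar0 : 0 < gbar) (q0 : 0 < q).

Lemma sqrt_bigmax_lt (z : 'I_K -> R) (y : R) : 0 < y ->
  (Num.sqrt (2 * q * \big[Num.max/0]_(k < K) (gbar / PL k * z k ^+ 2)) < y) =
  [forall k, `|z k| < Num.sqrt (PL k / (2 * q * gbar)) * y].
Proof.
move=> y0; have q2 : 0 < 2 * q by rewrite mulr_gt0.
set M := \big[Num.max/0]_(k < K) _.
have M0 : 0 <= 2 * q * M by rewrite mulr_ge0 ?bigmax_ge_id// ltW.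
have yE : Num.sqrt (y ^+ 2) = y by rewrite sqrtr_sqr gtr0_norm.
have -> : (Num.sqrt (2 * q * M) < y) = (M < y ^+ 2 / (2 * q)).
  by rewrite -{1}yE ltr_sqrt ?exprn_gt0// ltr_pdivlMr// mulrC.
have zE k : (gbar / PL k * z k ^+ 2 < y ^+ 2 / (2 * q)) =
    (`|z k| < Num.sqrt (PL k / (2 * q * gbar)) * y).
  have c0 : 0 < PL k / (2 * q * gbar) by rewrite divr_gt0// mulr_gt0.
  rewrite -{2}yE -sqrtr_sqr -sqrtrM ?(ltW c0)//.
  rewrite ltr_sqrt ?(mulr_gt0 c0 (exprn_gt0 _ y0))//.
  rewrite mulrAC ltr_pdivrMr// -[in RHS]mulrAC ltr_pdivlMr ?mulr_gt0//.
  rewrite mulrAC ltr_pdivlMr//; congr (_ < _); ring.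
apply/idP/forallP => [My k|zy].
  by rewrite -zE; apply: le_lt_trans My; exact: le_bigmax.
(* The base value 0 of the maximum also lies below the threshold, because [y > 0]. *)
apply: bigmax_lt => [|k _]; first by rewrite divr_gt0 ?exprn_gt0.
by rewrite zE.
Qed.

(** Separates the constant of the final formula from 1/sqrt(2q), which is the same for every surface
    and can be collected into a single power. *)
Lemma scale_decomp (P b : R) : 0 < P -> 0 < b ->
  Num.sqrt (P / (2 * q * gbar)) / b =
  Num.sqrt (P / (gbar * b ^+ 2)) / Num.sqrt (2 * q).
Proof.
move=> P0 b0; have q2 : 0 < 2 * q by rewrite mulr_gt0.
have -> : P / (2 * q * gbar) = P / (gbar * b ^+ 2) * b ^+ 2 * (2 * q)^-1.
  by field; rewrite !gt_eqF.
have c0 : 0 <= P / (gbar * b ^+ 2) by rewrite divr_ge0 ?mulr_ge0 ?ltW ?exprn_gt0.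
move: (P / _) c0 => v v0.
have vb0 : 0 <= v * b ^+ 2 by rewrite mulr_ge0 ?sqr_ge0.
rewrite (sqrtrM _ vb0) (sqrtrM _ v0) sqrtr_sqr gtr0_norm//.
rewrite sqrtrV ?(ltW q2)// mulrAC mulfK// gt_eqF//.
Qed.

End max_of_scaled_squares.

Lemma measurable_bigmax_ord d (T : measurableType d) (R : realType) K
    (f : 'I_K -> T -> R) : (forall k, measurable_fun setT (f k)) ->
  measurable_fun setT (fun t => \big[Num.max/0]_(k < K) f k t).
Proof.
move=> mf; elim: (index_enum 'I_K) => [|k s IH].
  by under eq_fun do rewrite big_nil; exact: measurable_cst.
by under eq_fun do rewrite big_cons; exact: measurable_maxr.
Qed.

Lemma measurable_sqrt (R : realType) : measurable_fun setT (@Num.sqrt R).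
Proof. by apply: continuous_measurable_fun; exact: sqrt_continuous. Qed.

(** * The dominating integral and the termwise integrals *)

Section main_integrals.
Context {R : realType}.
Notation mu := (@lebesgue_measure R).
Variables (K : nat) (a b PL : 'I_K -> R) (gbar q c : R).
Hypotheses (a0 : forall k, 0 < a k) (b0 : forall k, 0 < b k).
Hypotheses (PL0 : forall k, 0 < PL k) (gbar0 : 0 < gbar) (q0 : 0 < q).
Let w k : R := Num.sqrt (PL k / (2 * q * gbar)).

(** The product of the bounds collapses to a constant times y^A e^(B y), where [A] sums the shapes
    and [B] the rates w_k/b_k; the Gaussian weight makes this integrable. *)
Lemma integrable_gauss_prod :
  mu.-integrable `]0, +oo[%classic (EFin \o (fun y =>
    `|c * expR (- (y ^+ 2) / 2)| * \prod_(k < K)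
     ((w k * y / b k) `^ a k / (a k * Gammaf (a k)) * expR (w k * y / b k)))).
Proof.
have w0 k : 0 < w k by rewrite sqrtr_gt0 divr_gt0// !mulr_gt0.
pose A := \sum_(k < K) a k; pose B := \sum_(k < K) w k / b k.
pose C := `|c| * \prod_(k < K) ((w k / b k) `^ a k / (a k * Gammaf (a k))).
have A0 : 0 <= A by apply: sumr_ge0 => k _; exact: ltW.
apply: (@eq_integrable _ _ _ mu _ _ (fun y => C%:E *
    (EFin \o (fun t => expR (- (t ^+ 2) / 2) * (t `^ A * expR (B * t)))%R) y)%E) => //.
  move=> y; rewrite inE/= in_itv/= andbT => y0.
  rewrite -EFinM; congr EFin.
  have -> : \prod_(k < K)
      ((w k * y / b k) `^ a k / (a k * Gammaf (a k)) * expR (w k * y / b k)) =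
      \prod_(k < K) ((w k / b k) `^ a k / (a k * Gammaf (a k))) *
      (\prod_(k < K) y `^ a k * \prod_(k < K) expR (w k / b k * y)).
    rewrite -!big_split; apply: eq_bigr => k _ /=.
    have r0 : 0 <= w k / b k by rewrite divr_ge0 ?ltW.
    by rewrite [w k * y / b k]mulrAC (powRM _ r0 (ltW y0)); ring.
  rewrite (prod_powR _ _ _ _ _ y0) -expR_sum -mulr_suml normrM [`|expR _|]ger0_norm ?expR_ge0//.
  by rewrite /C; ring.
by apply: integrableZl => //; exact: integrable_powR_expR_gauss.
Qed.

(** The factors contribute powers of y/sqrt(2q) whose exponents add up to [S], so the integral is a
    constant times the Gaussian moment of order [S]. *)
Lemma Rintegral_gauss_prod (n : nat -> nat) :
  let S := \sum_(k < K) (a k + (n k)%:R) in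
  \int[mu]_(y in `]0, +oo[) (c * expR (- (y ^+ 2) / 2) *
    \prod_(k < K) gamma_cdf_term (a k) (b k) (n k) (w k * y)) =
  c * Num.sqrt q / Num.sqrt 2 * (\prod_(k < K)
        ((-1) ^+ n k *
         powR (Num.sqrt (PL k / (gbar * b k ^+ 2))) (a k + (n k)%:R) /
         ((n k)`!%:R * (a k + (n k)%:R) * Gammaf (a k)))) *
     Gammaf (S / 2 + 2^-1) / powR q (S / 2 + 2^-1).
Proof.
move=> S.
have S0 : 0 <= S by apply: sumr_ge0 => k _; rewrite addr_ge0// ltW.
have q2 : 0 < 2 * q by rewrite mulr_gt0.
set M := \prod_(k < K) _.
have E : {in `]0, +oo[%classic, (fun y : R => c * expR (- (y ^+ 2) / 2) *
    \prod_(k < K) gamma_cdf_term (a k) (b k) (n k) (w k * y)) =1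
    (fun y => c * M / Num.sqrt (2 * q) `^ S * (y `^ S * expR (- (y ^+ 2) / 2)))}.
  move=> y; rewrite inE/= in_itv/= andbT => y0.
  have -> : \prod_(k < K) gamma_cdf_term (a k) (b k) (n k) (w k * y) =
      M * \prod_(k < K) (y / Num.sqrt (2 * q)) `^ (a k + (n k)%:R).
    rewrite -big_split; apply: eq_bigr => k _ /=; rewrite /gamma_cdf_term.
    have -> : w k * y / b k =
        Num.sqrt (PL k / (gbar * b k ^+ 2)) * (y / Num.sqrt (2 * q)).
      by rewrite mulrAC scale_decomp//; ring.
    have yq0 : 0 <= y / Num.sqrt (2 * q) by rewrite divr_ge0 ?sqrtr_ge0 ?ltW.
    by rewrite (powRM _ (sqrtr_ge0 _) yq0); ring.
  rewrite prod_powR ?divr_gt0 ?sqrtr_gt0// powRM ?invr_ge0 ?sqrtr_ge0 ?(ltW y0)//.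
  have -> : (Num.sqrt (2 * q))^-1 `^ S = (Num.sqrt (2 * q) `^ S)^-1.
    by rewrite -[_^-1]powR_inv1 ?sqrtr_ge0// -powRrM mulN1r powRN.
  by ring.
rewrite (_ : \int[mu]_(y in _) _ = \int[mu]_(y in `]0, +oo[)
    (c * M / Num.sqrt (2 * q) `^ S * (y `^ S * expR (- (y ^+ 2) / 2)))); last first.
  by apply: eq_Rintegral => y y0; exact: E.
rewrite RintegralZl//; last exact: integrable_powR_gauss.
rewrite Rintegral_powR_gauss//.
(* The power of 2 in the moment cancels against the one in sqrt(2q)^S up to 1/sqrt(2); the factor
   sqrt(q) compensates for the extra 1/2 in the exponent of [q]. *)
have -> : 2 `^ ((S - 1) / 2) =
    Num.sqrt q / Num.sqrt 2 * Num.sqrt (2 * q) `^ S / q `^ (S / 2 + 2^-1).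
  rewrite -!powR12_sqrt ?(ltW q0) ?(ltW q2)//.
  rewrite !gt0_powR_expR// ?expR_gt0// expRK lnM ?posrE// -!expRN -!expRD.
  by congr expR; field.
by field; rewrite !gt_eqF// ?powR_gt0 ?sqrtr_gt0.
Qed.

End main_integrals.

(** * Assembly of the error probability *)

Theorem theorem4 (R : realType) (d : measure_display) (T : measurableType d)
  (P : probability T R) (K : nat) (a b PL : 'I_K -> R) (gbar p q : R)
  (Z : 'I_K -> T -> R) :
  (1 <= K)%N ->
  (forall k, 0 < a k) -> (forall k, 0 < b k) -> (forall k, 0 < PL k) ->
  0 < gbar -> 0 < p -> 0 < q ->
  mutually_independent P Z ->
  (forall k, gamma_distributed P (Z k) (a k) (b k)) ->
  let gam k t := gbar / PL k * Z k t ^+ 2 in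
  let gstar t := \big[Num.max/0]_(k < K) gam k t in
  (\int[P]_t (p * Qfun (Num.sqrt (2 * q * gstar t)))%:E)%E =
  (p * Num.sqrt q / (2 * Num.sqrt pi) *
   multi_series K (fun n =>
     let S := \sum_(k < K) (a k + (nth 0%N n k)%:R) in
     (\prod_(k < K)
        ((-1) ^+ nth 0%N n k *
         powR (Num.sqrt (PL k / (gbar * b k ^+ 2))) (a k + (nth 0%N n k)%:R) /
         ((nth 0%N n k)`!%:R * (a k + (nth 0%N n k)%:R) * Gammaf (a k)))) *
     Gammaf (S / 2 + 2^-1) / powR q (S / 2 + 2^-1)))%:E.
Proof.
move=> _ a0 b0 PL0 g0 p0 q0 indZ gamZ gam gstar.
set mu := @lebesgue_measure R.
pose w k : R := Num.sqrt (PL k / (2 * q * gbar)).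
have w0 k : 0 < w k by rewrite sqrtr_gt0 divr_gt0// !mulr_gt0.
pose gauss (y : R) : R := expR (- (y ^+ 2) / 2).
pose F k (y : R) : R := \int[mu]_(u in `]0, w k * y]) gamma_pdf (a k) (b k) u.
pose g k n (y : R) : R := gamma_cdf_term (a k) (b k) n (w k * y).
pose G k (y : R) : R :=
  (w k * y / b k) `^ a k / (a k * Gammaf (a k)) * expR (w k * y / b k).
(* Normalizing the weight by c makes its integrals against the products of the g
   equal to the summands themselves, so no constant has to cross multi_series. *)
pose c : R := Num.sqrt (2 / q).
have c0 : 0 < c by rewrite sqrtr_gt0 divr_gt0.
have mZ k : measurable_fun setT (Z k) by have [] := gamZ k.
have mX : measurable_fun setT (fun t => Num.sqrt (2 * q * gstar t)).
  apply: measurableT_comp; first exact: measurable_sqrt.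
  apply: measurable_funM => //; apply: measurable_bigmax_ord => k.
  by apply: measurable_funM => //; exact: measurable_funX.
(* The maximum is below its level exactly when every [Z k] lies in a symmetric interval, so
   independence factors the distribution function. *)
have PX y : 0 < y ->
    P [set t | Num.sqrt (2 * q * gstar t) < y] = (\prod_(k < K) F k y)%:E.
  move=> y0; pose B k : set R := `]- (w k * y), w k * y[%classic.
  have -> : [set t | Num.sqrt (2 * q * gstar t) < y] =
      \bigcap_(k in [set: 'I_K]) (Z k @^-1` B k).
    apply/seteqP; split=> t /=; rewrite sqrt_bigmax_lt//.
      by move=> /forallP Zt k _; rewrite /B/= in_itv/= -ltr_norml.
    move=> Zt; apply/forallP => k; rewrite ltr_norml.
    by have := Zt k I; rewrite /B/= in_itv.
  rewrite indZ; last by move=> k; exact: measurable_itv.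
  rewrite -prodEFin; apply: eq_bigr => k _.
  by rewrite (@gamma_distributed_sym_itv _ _ _ P _ (a k) (b k))// mulr_gt0.
have g_F k y : (`]0, +oo[%classic : set R) y -> series ((g k) ^~ y) @ \oo --> F k y.
  rewrite /= in_itv/= andbT => y0.
  by apply: cvg_series_gamma_cdf_term => //; rewrite mulr_gt0.
have g_G k n y : (`]0, +oo[%classic : set R) y -> \sum_(0 <= i < n) `|g k i y| <= G k y.
  rewrite /= in_itv/= andbT => y0.
  by apply: sum_gamma_cdf_term_le => //; rewrite mulr_gt0.
have mscale k (D : set R) : measurable_fun D (fun y => w k * y / b k).
  by apply: measurable_funM => //; exact: measurable_funM.
have mg k n (D : set R) : measurable_fun D (g k n).
  apply: measurable_funM => //; apply: measurable_funM => //.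
  by apply: (measurableT_comp (measurable_powR _)); exact: mscale.
have mG k (D : set R) : measurable_fun D (G k).
  apply: measurable_funM; last by apply: measurableT_comp => //; exact: mscale.
  apply: measurable_funM => //.
  by apply: (measurableT_comp (measurable_powR _)); exact: mscale.
have mh (D : set R) : measurable_fun D (fun y => c * gauss y).
  by apply: measurable_funM => //; exact: measurable_expR_sqr_half.
have iG : mu.-integrable `]0, +oo[%classic
    (EFin \o (fun y => `|c * gauss y| * \prod_(k < K) G k y)).
  exact: integrable_gauss_prod.
have mD : measurable (`]0, +oo[%classic : set R) by [].
have iF := integrable_prod_series_limit _ _ _ mu _ mD _ _ _ _ _
  (mh _) (fun k n => mg k n _) g_F g_G iG.
rewrite integral_Qfun ?ltW//.
transitivity ((p / Num.sqrt (2 * pi))%:E * ((c^-1 *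
    \int[mu]_(y in `]0, +oo[) (c * gauss y * \prod_(k < K) F k y))%:E))%E.
  congr (_ * _)%E; rewrite -RintegralZl// fineK; last first.
    by apply: integrable_fin_num => //; exact: (integrableZl _ c^-1 iF).
  apply: eq_integral => y; rewrite inE/= in_itv/= andbT => y0.
  by rewrite PX// -EFinM -!mulrA mulKf// gt_eqF.
rewrite -(multi_series_Rintegral _ _ _ mu _ mD _ _ _ _ _
  (mh _) (fun k n => mg k n _) (fun k => mG k _) g_F g_G iG).
rewrite -EFinM mulrA; congr (_ * _)%:E; last first.
  congr multi_series; apply/funext => n; rewrite (Rintegral_gauss_prod _ a b PL gbar)//.
  have -> : c * Num.sqrt q / Num.sqrt 2 = 1.
    rewrite /c sqrtrM// sqrtrV ?(ltW q0)//; field.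
    by rewrite !gt_eqF ?sqrtr_gt0.
  by rewrite mul1r.
rewrite /c !sqrtrM// sqrtrV ?(ltW q0)//.
(* Splitting 2 as sqrt(2)^2 lets [field] treat the square roots as independent atoms. *)
have -> : 2 * Num.sqrt pi = Num.sqrt 2 * (Num.sqrt 2 * Num.sqrt pi) :> R.
  by rewrite mulrA -expr2 sqr_sqrtr.
by field; rewrite !gt_eqF ?sqrtr_gt0 ?pi_gt0.
Qed.
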